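(* Let $d,m\ge1$ be integers, let $\mathcal{J}$ be an ideal on $\omega$, and let $A=(A_{n,k}:n,k\in\omega)$ be a matrix of linear operators $A_{n,k}:\mathbf{R}^d\to\mathbf{R}^m$, where $A_{n,k}$ is represented by the real matrix $[a_{n,k}(i,j):1\le i\le m,\,1\le j\le d]$. Suppose that $\mathcal{J}$ is countably generated or that $a_{n,k}(i,j)\ge0$ for all $1\le i\le m$, $1\le j\le d$, and $n,k\in\omega$. Then $A\in(\ell_\infty(\mathbf{R}^d),c_0^b(\mathbf{R}^m,\mathcal{J}))$ if and only if both of the following hold: (F1) $\sup_n\sum_k\sum_{i,j}|a_{n,k}(i,j)|<\infty$; (F3$'$) $\mathcal{J}\text{-}\lim_n\sum_k\sum_{i,j}|a_{n,k}(i,j)|=0$.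
   Context: $\omega$ is the set of nonnegative integers. An ideal on $\omega$ is a family of subsets of $\omega$ closed under subsets and finite unions; every ideal is assumed to contain all finite sets and to differ from the power set of $\omega$. An ideal $\mathcal{J}$ is countably generated if there is a sequence $(Q_j)$ of subsets of $\omega$ such that $S\in\mathcal{J}$ iff $S\subseteq\bigcup_{j\in F}Q_j$ for some finite $F\subseteq\omega$. $\mathcal{J}\text{-}\lim_nx_n=\eta$ means $\{n:x_n\notin U\}\in\mathcal{J}$ for every neighborhood $U$ of $\eta$. $\ell_\infty(V)$ is the space of bounded sequences in $V$, and $c_0^b(V,\mathcal{J})$ is the space of bounded sequences in $V$ with $\mathcal{J}$-limit $0$. $A\boldsymbol{x}=(A_n\boldsymbol{x})_n$ with $A_n\boldsymbol{x}=\sum_kA_{n,k}x_k$, provided each series converges. $A\in(\mathscr{A},\mathscr{B})$ means that $A\boldsymbol{x}$ is well defined and in $\mathscr{B}$ for every $\boldsymbol{x}\in\mathscr{A}$. *)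

(* Defs.v *)
From HB Require Import structures.
From mathcomp Require Import all_boot all_order all_algebra.
From mathcomp Require Import all_classical all_reals all_analysis.

Set Implicit Arguments.
Unset Strict Implicit.
Unset Printing Implicit Defensive.

Import Order.TTheory GRing.Theory Num.Theory.
Import numFieldNormedType.Exports.

Local Open Scope classical_set_scope.
Local Open Scope ring_scope.

Definition is_ideal (J : set (set nat)) : Prop :=
  [/\ forall S T : set nat, S `<=` T -> J T -> J S,
      forall S T : set nat, J S -> J T -> J (S `|` T),
      forall S : set nat, finite_set S -> J S
    & J <> setT].

Definition countably_generated (J : set (set nat)) : Prop :=
  exists Q : nat -> set nat, forall S : set nat,
    J S <-> exists F : set nat, finite_set F /\ S `<=` \bigcup_(j in F) Q j.

Definition ideal_lim (T : topologicalType) (J : set (set nat))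
    (x : nat -> T) (eta : T) : Prop :=
  forall U : set T, nbhs eta U -> J [set n | ~ U (x n)].

Definition ell_infty (R : realType) (V : normedModType R) : set (nat -> V) :=
  [set x | bounded_fun x].

Definition c0b (R : realType) (V : normedModType R) (J : set (set nat)) :
    set (nat -> V) :=
  [set x | bounded_fun x /\ ideal_lim J x 0].

Section matrix_transform.
Context (R : realType) (V W : normedModType R).
Implicit Types (A : nat -> nat -> {linear V -> W}) (x : nat -> V).

Definition transform_def A x : Prop :=
  forall n, cvgn (series (fun k => A n k (x k))).

(* Meaningful only when [transform_def A x]: [limn] has a junk value on a
   divergent series. *)
Definition transform A x : nat -> W :=
  fun n => limn (series (fun k => A n k (x k))).

Definition matrix_class (X : set (nat -> V)) (Y : set (nat -> W)) A : Prop :=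
  forall x, X x -> transform_def A x /\ Y (transform A x).

End matrix_transform.

(* An extended real, so that divergence of the series is the value [+oo]. *)
Definition row_sum (R : realType) (m d : nat)
    (a : nat -> nat -> 'M[R]_(m, d)) (n : nat) : \bar R :=
  (\sum_(0 <= k <oo) (\sum_(i < m) \sum_(j < d) `|a n k i j|)%:E)%E.

(* Main.v *)
Require Import Defs.
From HB Require Import structures.
From mathcomp Require Import all_boot all_order all_algebra.
From mathcomp Require Import all_classical all_reals all_analysis.
From mathcomp Require Import lra.
Import Order.TTheory GRing.Theory Num.Theory.
Import numFieldNormedType.Exports.
Local Open Scope classical_set_scope.
Local Open Scope ring_scope.

(** A matrix of row sum at most [C] maps a sequence bounded by [B] to one
    bounded, row by row, by [B] times the row sum ([series_mulmx_bound]); this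
    settles the sufficiency of the two conditions.

    For the necessity, testing [A] on sequences whose only nonzero coordinate is
    the [j]-th, and reading the [i]-th coordinate of the result, shows that every
    scalar matrix [a n k i j], with [i] and [j] fixed, maps bounded sequences to
    bounded sequences with J-limit 0 ([matrix_class_entry]).  A row sum is the
    finite sum over [i], [j] of the l1 norms of the scalar rows
    ([cvg_series_entry_sum]), so it is enough to bound these norms and to show
    that their J-limit is 0.

    Both facts come from Schur's theorem ([schur]): if a scalar matrix maps
    bounded sequences to sequences tending to 0, then the l1 norms of its rows
    tend to 0.  Were they to stay above some e infinitely often, a gliding hump
    ([gliding_hump]) would pick rows whose masses are concentrated on disjoint
    blocks of columns; the sequence that copies on each block the signs of the
    row living there keeps infinitely many coordinates of the image above e / 2.

    - Boundedness of the norms ([l1norm_bounded]): if the norms were unbounded,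
      pick a row u(p) of norm larger than p + 1 and divide it by p + 1.  The new
      matrix still maps bounded sequences to null sequences, as the original one
      maps them to bounded sequences, while its rows have norm larger than 1;
      this contradicts Schur's theorem.
    - J-limit 0 of the norms ([cvg_l1norm]): for nonnegative entries, the norm of
      a row is its value on the constant sequence 1.  If J is countably
      generated, a set outside J contains a sequence u that leaves every member
      of J eventually ([countably_generated_sequence]).  Convergence along J thus
      becomes ordinary convergence along u, and Schur's theorem applies to the
      matrix of the rows u(p).

    An ideal is handled through its dual filter, so that J-limits are limits
    along a filter and the general calculus of limits applies to them. *)

Set Implicit Arguments.
Unset Strict Implicit.
Unset Printing Implicit Defensive.

(** * Rows of scalars acting on bounded sequences *)

Section real_rows.
Variable R : realType.
Implicit Types (b x : nat -> R).

Definition apply_row b x : R := limn (series (fun k => b k * x k)).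

Definition l1norm b : R := limn (series (fun k => `|b k|)).

Definition unit_ball_seq x := forall k, `|x k| <= 1.

(** By homogeneity, the action on all bounded sequences is determined by the
    unit ball of the sup norm. *)
Definition acts_on_bounded (b : nat -> R) :=
  forall x, unit_ball_seq x -> cvgn (series (fun k => b k * x k)).

Lemma normr_sg_le1 (c : R) : `|Num.sg c| <= 1.
Proof. by rewrite normr_sg; case: (c != 0); rewrite ?ler01. Qed.

(** The sign sequence of [b] turns the series of the action into the series of
    absolute values. *)
Lemma acts_on_bounded_summable b : acts_on_bounded b -> cvgn (series (fun k => `|b k|)).
Proof.
move=> /(_ (Num.sg \o b)) /(_ (fun k => normr_sg_le1 (b k))).
suff -> : (fun k => b k * (Num.sg \o b) k) = (fun k => `|b k|) by [].
by apply/funext => k /=; rewrite mulrC -normrEsg.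
Qed.

Lemma unit_ball_seq_indic k0 : unit_ball_seq (fun k => (k == k0)%:R).
Proof. by move=> k; rewrite normr_nat; case: (k == k0); rewrite ?ler01. Qed.

Lemma apply_row_indic b k0 : apply_row b (fun k => (k == k0)%:R) = b k0.
Proof.
apply/lim_near_cst; first exact: Rhausdorff.
near=> N; rewrite seriesEnat /= big_mkord.
have k0N : (k0 < N)%N by near: N; exact: nbhs_infty_gt.
rewrite (bigD1 (Ordinal k0N)) //= eqxx mulr1 big1 ?addr0 // => i.
by rewrite -val_eqE /= => /negPf ->; rewrite mulr0.
Unshelve. all: by end_near. Qed.

Lemma abs_series_ge0 b N : 0 <= series (fun k => `|b k|) N.
Proof. by rewrite seriesEnat /=; apply: sumr_ge0. Qed.

Lemma abs_series_le_l1norm b : cvgn (series (fun k => `|b k|)) ->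
  forall N, series (fun k => `|b k|) N <= l1norm b.
Proof.
move=> cb N; apply: nondecreasing_cvgn_le => //.
by apply/nondecreasing_seqP => n; rewrite !seriesEnat /= big_nat_recr //= lerDl.
Qed.

Lemma l1norm_ge0 b : cvgn (series (fun k => `|b k|)) -> 0 <= l1norm b.
Proof.
by move=> cb; exact: le_trans (abs_series_ge0 b 0%N) (abs_series_le_l1norm cb 0%N).
Qed.

(** On the block [K0 <= k < K] the terms [b k * x k] and [`|b k|] agree; anywhere
    else they differ by at most [2 * `|b k|].  Hence the action on [x] falls short
    of the full norm by at most twice the mass of [b] outside the block. *)
Lemma hump_bound b x (K0 K : nat) : acts_on_bounded b -> unit_ball_seq x ->
    (K0 <= K)%N ->
    (forall k, (K0 <= k < K)%N -> x k = Num.sg (b k)) ->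
  l1norm b - 2 * series (fun k => `|b k|) K0 -
      2 * (l1norm b - series (fun k => `|b k|) K) <= apply_row b x.
Proof.
move=> hb hx hK hs.
have cb := acts_on_bounded_summable hb; have cx := hb _ hx.
suff : l1norm b - apply_row b x <=
    2 * series (fun k => `|b k|) K0 +
    2 * (l1norm b - series (fun k => `|b k|) K) by lra.
rewrite -lim_seriesB //; apply: limr_le; first exact: is_cvg_seriesB.
near=> N.
have KN : (K <= N)%N by near: N; exact: nbhs_infty_ge.
have := abs_series_le_l1norm cb N.
rewrite !seriesEnat /= => bN.
have hle k : `|b k| - b k * x k <= 2 * `|b k|.
  have : - (b k * x k) <= `|b k|.
    rewrite lerNl; apply: le_trans (_ : - `|b k * x k| <= _).
      by rewrite lerN2 normrM ler_piMr.
    by rewrite lerNl -normrN ler_norm.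
  lra.
have hsum p q : \sum_(p <= k < q) (`|b k| - b k * x k) <=
    2 * \sum_(p <= k < q) `|b k|.
  by rewrite mulr_sumr ler_sum.
have h1 := hsum 0%N K0; have h3 := hsum K N.
have h2 : \sum_(K0 <= k < K) (`|b k| - b k * x k) = 0.
  rewrite big_nat big1 // => k /hs ->.
  by rewrite [b k * _]mulrC -normrEsg subrr.
have hcat (f : nat -> R) p q r : (p <= q)%N -> (q <= r)%N ->
    \sum_(p <= k < r) f k = \sum_(p <= k < q) f k + \sum_(q <= k < r) f k.
  by move=> pq qr; rewrite (big_cat_nat pq qr).
rewrite (hcat _ 0%N K N) // (hcat _ 0%N K0 K) //= h2.
move: bN; rewrite (hcat _ 0%N K N) //=.
lra.
Unshelve. all: by end_near. Qed.

Lemma block_unique (c : nat -> nat) (p q k : nat) :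
    {homo c : i j / (i < j)%N} ->
  (c p <= k < c p.+1)%N -> (c q <= k < c q.+1)%N -> p = q.
Proof.
move=> cinc; have cmono : {homo c : i j / (i <= j)%N}.
  move=> i j; rewrite leq_eqVlt => /predU1P[->//|ij].
  exact/ltnW/cinc.
move=> /andP[pk kp] /andP[qk kq]; apply/eqP; rewrite eqn_leq.
apply/andP; split; rewrite leqNgt; apply/negP => /cmono h.
  by have := leq_ltn_trans (leq_trans h pk) kq; rewrite ltnn.
by have := leq_ltn_trans (leq_trans h qk) kp; rewrite ltnn.
Qed.

(** Columns tend to 0, so far enough down a large row has little mass on any
    given initial segment of columns, and, being summable, little mass far to the
    right.  Iterating, one gets rows with nearly all their mass on consecutive
    blocks, and the signs on the blocks glue into one sequence of norm at most
    1. *)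
Lemma gliding_hump (b : nat -> nat -> R) (e : R) : 0 < e ->
    (forall n, acts_on_bounded (b n)) ->
    (forall k, b n k @[n --> \oo] --> 0) ->
    (forall N, exists2 n, (N <= n)%N & e <= l1norm (b n)) ->
  exists2 x, unit_ball_seq x &
    forall N, exists2 n, (N <= n)%N & e / 2 <= apply_row (b n) x.
Proof.
move=> e0 hb hcol hbig.
(* Twice the masses on the left and on the right of a block, each below e / 8,
   cost at most e / 2 in [hump_bound]. *)
have e8 : 0 < e / 8 by rewrite divr_gt0.
(* A state is a pair (row, column): the next row has its mass between the column
   of the current state and that of the next one. *)
pose next (s t : nat * nat) := [/\ (s.1 < t.1)%N, (s.2 < t.2)%N,
  e <= l1norm (b t.1), series (fun k => `|b t.1 k|) s.2 < e / 8
  & l1norm (b t.1) - series (fun k => `|b t.1 k|) t.2 < e / 8].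
have next_ex s : exists t, next s t.
  have /cvgr0Pnorm_lt/(_ _ e8)[N _ hN] :
      series (fun k => `|b n k|) s.2 @[n --> \oo] --> 0.
    rewrite (_ : 0 = \sum_(0 <= k < s.2) `|0 : R|); last first.
      by rewrite big1 // => i _; rewrite normr0.
    under eq_fun do rewrite seriesEnat /=.
    apply: cvg_big => [|i _]; first exact: add_continuous.
    exact: cvg_norm.
  have [n nN ne] := hbig (maxn N s.1.+1).
  have /cvgrPdist_lt/(_ _ e8)[K _ hK] := acts_on_bounded_summable (hb n).
  exists (n, maxn K s.2.+1); split => //=.
  - exact: leq_trans (leq_maxr _ _) nN.
  - exact: leq_maxr.
  - apply: le_lt_trans (ler_norm _) _; apply: hN => /=.
    exact: leq_trans (leq_maxl _ _) nN.
  - by apply: le_lt_trans (ler_norm _) _; apply: hK; rewrite /= leq_maxl.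
have [nx nxP] := choice next_ex.
pose s p := iter p nx (0%N, 0%N).
have sS p : next (s p) (s p.+1) by exact: nxP.
have s1_inc p : (p <= (s p).1)%N.
  by elim: p => [//|p ih]; have [h _ _ _ _] := sS p; exact: leq_ltn_trans ih h.
have s2_inc p : (p <= (s p).2)%N.
  by elim: p => [//|p ih]; have [_ h _ _ _] := sS p; exact: leq_ltn_trans ih h.
have s2_mono : {homo (fun p => (s p).2) : i j / (i < j)%N}.
  by apply: homo_ltn; [exact: ltn_trans | move=> p; have [] := sS p].
pose inblock k p := ((s p).2 <= k < (s p.+1).2)%N.
have block_ex k : exists p, inblock k p.
  have hex : exists p, (k < (s p).2)%N by exists k.+1; exact: s2_inc.
  case: (ex_minnP hex) => -[//|p] kp pmin; exists p.
  rewrite /inblock kp andbT leqNgt; apply/negP => /pmin.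
  by rewrite ltnn.
have [blk blkP] := choice block_ex.
exists (fun k => Num.sg (b (s (blk k).+1).1 k)) => [k|N]; first exact: normr_sg_le1.
have [h1 h2 h3 h4 h5] := sS N.
exists (s N.+1).1; first by apply: leq_trans (s1_inc _).
apply: le_trans (hump_bound (hb _) _ (ltnW h2) _); first last.
- move=> k hk; congr (Num.sg (b (s _.+1).1 k)).
  exact: (block_unique s2_mono (blkP k) hk).
- by move=> k; exact: normr_sg_le1.
- lra.
Qed.

(** Schur's theorem.  The indicator of a column shows that the columns tend to 0,
    as [gliding_hump] requires. *)
Lemma schur (b : nat -> nat -> R) :
    (forall n, acts_on_bounded (b n)) ->
    (forall x, unit_ball_seq x -> apply_row (b n) x @[n --> \oo] --> 0) ->
  l1norm (b n) @[n --> \oo] --> 0.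
Proof.
move=> hb hlim; apply/cvgr0Pnorm_lt => e e0; apply: contrapT => hfreq.
have hbig N : exists2 n, (N <= n)%N & e <= l1norm (b n).
  apply: contrapT => hN; apply: hfreq; exists N => // n /= Nn.
  rewrite ger0_norm; last exact/l1norm_ge0/acts_on_bounded_summable.
  by rewrite ltNge; apply/negP => en; apply: hN; exists n.
have hcol k : b n k @[n --> \oo] --> 0.
  have := hlim _ (unit_ball_seq_indic k).
  by under eq_fun do rewrite apply_row_indic.
have [x hx hump] := gliding_hump e0 hb hcol hbig.
have e2 : 0 < e / 2 by rewrite divr_gt0.
have /cvgr0Pnorm_lt/(_ _ e2)[N _ hN] := hlim x hx.
have [n Nn] := hump N.
by apply/negP; rewrite -ltNge; exact: le_lt_trans (ler_norm _) (hN n Nn).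
Qed.

Lemma acts_on_boundedZ (c : R) b : acts_on_bounded b ->
  acts_on_bounded (fun k => c * b k).
Proof.
move=> hb x /hb cx.
under eq_fun do rewrite -mulrA.
exact: (is_cvg_seriesZ (V := R)).
Qed.

Lemma apply_rowZ (c : R) b x : cvgn (series (fun k => b k * x k)) ->
  apply_row (fun k => c * b k) x = c * apply_row b x.
Proof.
move=> cx; rewrite /apply_row; under eq_fun do rewrite -mulrA.
exact: (lim_seriesZ (V := R)).
Qed.

Lemma l1normZ (c : R) b : 0 <= c -> cvgn (series (fun k => `|b k|)) ->
  l1norm (fun k => c * b k) = c * l1norm b.
Proof.
move=> c0 cb; rewrite /l1norm.
under eq_fun do rewrite normrM (ger0_norm c0).
exact: (lim_seriesZ (V := R)).
Qed.

(** A uniform boundedness principle, obtained from Schur's theorem by rescaling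
    rows of rapidly growing norm. *)
Lemma l1norm_bounded (b : nat -> nat -> R) :
    (forall n, acts_on_bounded (b n)) ->
    (forall x, unit_ball_seq x -> exists M, forall n, `|apply_row (b n) x| <= M) ->
  exists M, forall n, l1norm (b n) <= M.
Proof.
move=> hb hbd; apply: contrapT => hunb.
have big_row p : exists n, p.+1%:R < l1norm (b n).
  apply: contrapT => hp; apply: hunb; exists p.+1%:R => n.
  by rewrite leNgt; apply/negP => h; apply: hp; exists n.
have [u uP] := choice big_row.
pose c (p : nat) : R := p.+1%:R^-1.
have hB p : acts_on_bounded (fun k => c p * b (u p) k).
  exact/acts_on_boundedZ/hb.
have /(schur hB) : forall x, unit_ball_seq x ->
    apply_row (fun k => c p * b (u p) k) x @[p --> \oo] --> 0.
  move=> x hx; under eq_fun do rewrite (apply_rowZ _ (hb _ _ hx)).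
  have [M hM] := hbd x hx.
  apply/norm_cvg0P; apply: (squeeze_cvgr (f := cst 0) (h := fun p => c p * M)).
  - near=> p; rewrite normr_ge0 normrM ger0_norm ?invr_ge0 //=.
    by rewrite ler_wpM2l ?invr_ge0.
  - exact: cvg_cst.
  - by rewrite -[X in _ --> X](mul0r M); apply: cvgMr_tmp; exact: cvg_harmonic.
move=> /cvgr0Pnorm_lt/(_ _ ltr01)[N _ /(_ N (leqnn N))].
apply/negP; rewrite -leNgt; apply: le_trans (ler_norm _).
rewrite l1normZ ?invr_ge0 //; last exact/acts_on_bounded_summable/hb.
rewrite /c mulrC ler_pdivlMr ?ltr0n // mul1r.
exact: ltW.
Unshelve. all: by end_near. Qed.

End real_rows.

(** * Limits along an ideal *)

Definition dual_filter (J : set (set nat)) : set_system nat :=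
  [set S | J (~` S)].

Lemma dual_filter_filter J : is_ideal J -> Filter (dual_filter J).
Proof.
move=> [Jsub JU Jfin _]; split; rewrite /dual_filter.
- by rewrite /= setCT; apply: Jfin; exact: finite_set0.
- by move=> P Q JP JQ; rewrite /= setCI; exact: JU.
- by move=> P Q PQ; apply: Jsub; exact: subsetC.
Qed.

(** The first [p] generators of [J] cannot cover [S], so [u p] can be chosen in
    [S] outside of them.  A member of [J] is covered by finitely many generators,
    so [u] meets it finitely often. *)
Lemma countably_generated_sequence J S : is_ideal J -> countably_generated J ->
  ~ J S -> exists2 u : nat -> nat, forall p, S (u p) & u @ \oo --> dual_filter J.
Proof.
move=> [Jsub _ _ _] [Q QP] JS.
pose U p := \bigcup_(j in `I_p) Q j.
have JU p : J (U p) by apply/QP; exists `I_p; split => //; exact: finite_II.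
have pick p : exists n, S n /\ ~ U p n.
  apply: contrapT => h; apply: JS; apply: Jsub (JU p) => n Sn.
  by apply: contrapT => nU; apply: h; exists n.
have [u uP] := choice pick.
exists u => [p|T /QP [F [/finite_seqP [s ->]] TF]]; first by have [] := uP p.
exists (\max_(j <- s) j.+1)%N => // p /= sp.
apply: contrapT => /TF [j /= js Qj].
have [_ nU] := uP p; apply: nU; exists j => //=.
exact: leq_trans (leq_bigmax_seq (F := succn) j js isT) sp.
Qed.

(** For a countably generated [J], a neighbourhood of 0 that the norms leave on a
    set outside [J] gives a sequence of rows along which they always stay out of
    it, against Schur's theorem. *)
Lemma cvg_l1norm (R : realType) (J : set (set nat)) (b : nat -> nat -> R) :
    is_ideal J ->
    countably_generated J \/ (forall n k, 0 <= b n k) ->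
    (forall n, acts_on_bounded (b n)) ->
    (forall x, unit_ball_seq x -> apply_row (b n) x @[n --> dual_filter J] --> 0) ->
  l1norm (b n) @[n --> dual_filter J] --> 0.
Proof.
move=> hJ [cJ|b0] hb hlim; last first.
  have h1 : unit_ball_seq (fun=> 1 : R) by move=> k; rewrite normr1.
  suff <- : (fun n => apply_row (b n) (fun=> 1)) = (fun n => l1norm (b n)).
    exact: hlim.
  apply/funext => n; congr (limn (series _)); apply/funext => k.
  by rewrite mulr1 ger0_norm.
have FJ := dual_filter_filter hJ.
move=> U U0; apply: contrapT => nJU.
have [u uU uJ] := countably_generated_sequence hJ cJ nJU.
have : l1norm (b (u p)) @[p --> \oo] --> 0.
  apply: schur => [p|x hx]; first exact: hb.
  exact: cvg_comp _ _ uJ (hlim x hx).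
by move=> /(_ U U0) [N _ /(_ N (leqnn N))]; exact: uU.
Qed.

(** The two notions are convertible: the preimage of [U] is in the dual filter
    exactly when its complement is in [J]. *)
Lemma ideal_limP (T : topologicalType) J (x : nat -> T) (l : T) :
  ideal_lim J x l <-> x @ dual_filter J --> l.
Proof. by []. Qed.

(** * Matrices of operators and their scalar entries *)

(** Completeness of matrices over [R] joins here with their norm, so that absolute
    convergence implies convergence for series of vectors. *)
HB.instance Definition _ (R : realType) (m n : nat) :=
  Uniform_isComplete.Build 'M[R]_(m, n) (@mx_complete R m n).

Section matrices.
Variables (R : realType).

Lemma norm_entry_le (m n : nat) (M : 'M[R]_(m, n)) i j : `|M i j| <= `|M|.
Proof.
by rewrite [leRHS]/Num.norm /= mx_normrE; apply/bigmax_geP; right => /=; exists (i, j).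
Qed.

Lemma norm_mx_le (m n : nat) (M : 'M[R]_(m, n)) (c : R) : 0 <= c ->
  (forall i j, `|M i j| <= c) -> `|M| <= c.
Proof.
by move=> c0 Mc; rewrite [leLHS]/Num.norm /= mx_normrE; apply/bigmax_leP; split => // -[].
Qed.

Lemma bounded_funP (T : Type) (V : normedModType R) (f : T -> V) :
  bounded_fun f <-> exists M, forall t, `|f t| <= M.
Proof.
split=> [[M [_ fM]]|[M fM]].
  by exists (M + 1) => t; apply: fM => //; rewrite ltrDl.
exists M; split; first exact: num_real.
by move=> y My t _; exact: le_trans (fM t) (ltW My).
Qed.

Variables (m d : nat).
Implicit Types (a : nat -> nat -> 'M[R]_(m, d)).

Definition entry_sum (M : 'M[R]_(m, d)) : R := \sum_(i < m) \sum_(j < d) `|M i j|.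

Lemma entry_sum_ge0 M : 0 <= entry_sum M.
Proof. by apply: sumr_ge0 => i _; apply: sumr_ge0. Qed.

Lemma norm_mulmx_le (M : 'M[R]_(m, d)) (v : 'cV[R]_d) :
  `|M *m v| <= entry_sum M * `|v|.
Proof.
apply: norm_mx_le => [|i k]; first by rewrite mulr_ge0 ?entry_sum_ge0.
rewrite mxE; apply: le_trans (ler_norm_sum _ _ _) _.
apply: (@le_trans _ _ ((\sum_(j < d) `|M i j|) * `|v|)).
  by rewrite mulr_suml ler_sum // => j _; rewrite normrM ler_wpM2l ?norm_entry_le.
rewrite ler_wpM2r // /entry_sum (bigD1 i) //= lerDl.
by apply: sumr_ge0 => ? _; apply: sumr_ge0.
Qed.

Lemma row_sumE a n : cvgn (series (fun k => entry_sum (a n k))) ->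
  row_sum a n = (limn (series (fun k => entry_sum (a n k))))%:E.
Proof.
move=> cs; rewrite -EFin_lim //; congr (limn _); apply/funext => N /=.
by rewrite seriesEnat /= sumEFin.
Qed.

Lemma cvg_series_entry_sum (M : nat -> 'M[R]_(m, d)) :
  (forall i j, cvgn (series (fun k => `|M k i j|))) ->
  series (fun k => entry_sum (M k)) @ \oo -->
    \sum_(i < m) \sum_(j < d) l1norm (fun k => M k i j).
Proof.
move=> cM.
have -> : series (fun k => entry_sum (M k)) =
    (fun N => \sum_(i < m) \sum_(j < d) series (fun k => `|M k i j|) N).
  apply/funext => N; rewrite seriesEnat /= /entry_sum exchange_big /=.
  apply: eq_bigr => i _; rewrite exchange_big /=.
  by apply: eq_bigr => j _; rewrite seriesEnat.
apply: cvg_big => [|i _]; first exact: add_continuous.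
by apply: cvg_big => [|j _]; [exact: add_continuous | exact: cM].
Qed.

Lemma entry_series (A : nat -> nat -> {linear 'cV[R]_d -> 'cV[R]_m}) a
    (hA : forall n k v, A n k v = a n k *m v) (i : 'I_m) (j : 'I_d) (y : nat -> R) n :
  (fun k => a n k i j * y k) = (fun k => A n k (y k *: delta_mx j 0) i 0).
Proof.
apply/funext => k; rewrite hA mxE (bigD1 j) //= big1 => [|l lj].
  by rewrite !mxE !eqxx mulr1 addr0.
by rewrite !mxE (negPf lj) !mulr0.
Qed.

Lemma series_entry (u : nat -> 'cV[R]_m) i N :
  series (fun k => u k i 0) N = series u N i 0.
Proof. by rewrite !seriesEnat /= summxE. Qed.

Lemma cvg_entry (T : Type) (F : set_system T) (f : T -> 'cV[R]_m) (l : 'cV[R]_m) i :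
  Filter F -> f @ F --> l -> f t i 0 @[t --> F] --> l i 0.
Proof.
move=> FF fl.
exact: cvg_comp _ _ fl (@coord_continuous R m 1 i 0 l).
Qed.

(** Feeding [A] with [y k] times the [j]-th basis vector and reading the [i]-th
    coordinate isolates the scalar matrix of the entries at [(i, j)]. *)
Lemma matrix_class_entry (Y : set (nat -> 'cV[R]_m))
    (A : nat -> nat -> {linear 'cV[R]_d -> 'cV[R]_m}) a
    (hA : forall n k v, A n k v = a n k *m v) (i : 'I_m) (j : 'I_d) (y : nat -> R) :
    matrix_class (ell_infty (V := 'cV[R]_d)) Y A -> unit_ball_seq y ->
  (forall n, cvgn (series (fun k => a n k i j * y k))) /\
  exists2 z, Y z & forall n, apply_row (fun k => a n k i j) y = z n i 0.
Proof.
move=> hcl hy.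
have hx : ell_infty (V := 'cV[R]_d) (fun k => y k *: delta_mx j 0).
  apply/bounded_funP; exists 1 => k; apply: norm_mx_le => // i' j'.
  rewrite !mxE normrM normr_nat; case: (_ && _); rewrite ?mulr1 ?mulr0 //.
have [cT YT] := hcl _ hx.
have cv n : series (fun k => a n k i j * y k) @ \oo -->
    transform A (fun k => y k *: delta_mx j 0) n i 0.
  have -> : series (fun k => a n k i j * y k) =
      (fun N => series (fun k => A n k (y k *: delta_mx j 0)) N i 0).
    by apply/funext => N; rewrite -series_entry (entry_series hA).
  by apply: cvg_entry; exact: cT.
split=> [n|]; first by apply/cvg_ex; eexists; exact: cv.
exists (transform A (fun k => y k *: delta_mx j 0)) => // n.
exact: (cvg_lim _ (cv n)).
Qed.

Lemma series_mulmx_bound (M : nat -> 'M[R]_(m, d)) (x : nat -> 'cV[R]_d) (B : R) :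
    cvgn (series (fun k => entry_sum (M k))) -> (forall k, `|x k| <= B) ->
  cvgn (series (fun k => M k *m x k)) /\
  `|limn (series (fun k => M k *m x k))| <=
    B * limn (series (fun k => entry_sum (M k))).
Proof.
move=> cM xB; have B0 : 0 <= B := le_trans (normr_ge0 _) (xB 0%N).
have cBM : cvgn (series (B *: (fun k => entry_sum (M k) : R^o))).
  exact: (is_cvg_seriesZ (V := R)).
have le_BM k : `|M k *m x k| <= (B *: (fun k => entry_sum (M k) : R^o)) k.
  apply: le_trans (norm_mulmx_le _ _) _.
  by rewrite mulrC; apply: ler_wpM2r (xB k); exact: entry_sum_ge0.
have cn : cvgn [normed series (fun k => M k *m x k)].
  apply: (series_le_cvg _ _ le_BM cBM) => // k.
  exact: le_trans (normr_ge0 _) (le_BM k).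
split; first exact: normed_cvg.
apply: le_trans (lim_series_norm cn) _.
have <- : limn (series (B *: (fun k => entry_sum (M k) : R^o))) =
    B * limn (series (fun k => entry_sum (M k))) by exact: (lim_seriesZ (V := R)).
exact: lim_series_le.
Qed.

End matrices.

(** * The characterization *)

Set Printing Implicit Defensive.
Set Strict Implicit.
Unset Implicit Arguments.

Theorem corollary2p12 (R : realType) (d m : nat)
    (hd : (1 <= d)%N) (hm : (1 <= m)%N)
    (J : set (set nat)) (hJ : is_ideal J)
    (A : nat -> nat -> {linear 'cV[R]_d -> 'cV[R]_m})
    (a : nat -> nat -> 'M[R]_(m, d))
    (hA : forall (n k : nat) (v : 'cV[R]_d), A n k v = a n k *m v)
    (hJa : countably_generated J \/
           (forall (n k : nat) (i : 'I_m) (j : 'I_d), 0 <= a n k i j)) :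
  matrix_class (ell_infty (V := 'cV[R]_d)) (c0b (V := 'cV[R]_m) J) A <->
  ((ereal_sup (range (row_sum a)) < +oo)%E /\
   ideal_lim J (row_sum a) 0%E).
Proof.
have FJ := dual_filter_filter hJ.
split=> [hcl|[F1 F3]].
- have hb i j n : acts_on_bounded (fun k => a n k i j).
    by move=> y hy; have [] := matrix_class_entry hA i j hcl hy.
  have cb n i j := acts_on_bounded_summable (hb i j n).
  have row n := cvg_series_entry_sum (cb n).
  have rowE n : row_sum a n =
      (\sum_(i < m) \sum_(j < d) l1norm (fun k => a n k i j))%:E.
    rewrite row_sumE; last by apply/cvg_ex; eexists; exact: row.
    by congr EFin; exact: (cvg_lim _ (row n)).
  split.
    have bd i j : exists M, forall n, l1norm (fun k => a n k i j) <= M.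
      apply: (l1norm_bounded (hb i j)) => y hy.
      have [_ [z [/bounded_funP[M hM] _] zE]] := matrix_class_entry hA i j hcl hy.
      exists M => n; rewrite zE; exact: le_trans (norm_entry_le _ _ _) (hM n).
    have [M hM] := choice (fun ij => bd ij.1 ij.2).
    apply: (@le_lt_trans _ _ (\sum_(i < m) \sum_(j < d) M (i, j))%:E); last exact: ltry.
    apply: ge_ereal_sup => _ [n _ <-]; rewrite rowE lee_fin.
    by apply: ler_sum => i _; apply: ler_sum => j _; exact: (hM (i, j)).
  apply/ideal_limP; rewrite (funext rowE).
  suff S0 : \sum_(i < m) \sum_(j < d) l1norm (fun k => a n k i j)
      @[n --> dual_filter J] --> (0 : R).
    by apply: cvg_EFin S0; near=> n.
  rewrite [X in _ --> X](_ : 0 = \sum_(i < m) \sum_(j < d) (0 : R)); last first.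
    by rewrite big1 // => i _; rewrite big1.
  apply: cvg_big => [|i _]; first exact: add_continuous.
  apply: cvg_big => [|j _]; first exact: add_continuous.
  apply: cvg_l1norm => //.
    by case: hJa => [|h]; [left | right].
  move=> y hy; have [_ [z [_ /ideal_limP z0] zE]] := matrix_class_entry hA i j hcl hy.
  under eq_fun do rewrite zE.
  have := @cvg_entry R m _ _ z 0 i FJ z0.
  by rewrite mxE.
- have sum_lt n : (row_sum a n < +oo)%E.
    by apply: le_lt_trans F1; apply: ereal_sup_ubound; exists n.
  have cs n : cvgn (series (fun k => entry_sum (a n k))).
    by apply: nnseries_is_cvg (sum_lt n) => k; exact: entry_sum_ge0.
  pose r n := limn (series (fun k => entry_sum (a n k))).
  have rE n : row_sum a n = (r n)%:E by exact: row_sumE.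
  have [C rC] : exists C, forall n, r n <= C.
    exists (fine (ereal_sup (range (row_sum a)))) => n.
    have le_sup : ((r n)%:E <= ereal_sup (range (row_sum a)))%E.
      by rewrite -rE; apply: ereal_sup_ubound; exists n.
    by rewrite -lee_fin fineK // fin_real // F1 andbT (lt_le_trans (ltNyr _) le_sup).
  have r0 : r n @[n --> dual_filter J] --> 0.
    move/ideal_limP: F3; rewrite (funext rE) => rF.
    exact: fine_cvg rF.
  move=> x /bounded_funP[B xB].
  have tE n : (fun k => A n k (x k)) = (fun k => a n k *m x k).
    by apply/funext => k; rewrite hA.
  have bound n := series_mulmx_bound (cs n) xB.
  have B0 : 0 <= B := le_trans (normr_ge0 _) (xB 0%N).
  have trE : transform A x = fun n => limn (series (fun k => a n k *m x k)).
    by apply/funext => n; rewrite /transform tE.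
  split; first by move=> n; rewrite tE; have [] := bound n.
  rewrite trE; split.
    apply/bounded_funP; exists (B * C) => n.
    have [_ le_Br] := bound n; apply: le_trans le_Br _.
    exact: ler_wpM2l (rC n).
  apply/ideal_limP/norm_cvg0P.
  apply: (squeeze_cvgr (f := cst 0) (h := fun n => B * r n)).
  - by near=> n; rewrite normr_ge0 /=; have [] := bound n.
  - exact: cvg_cst.
  - by rewrite -[X in _ --> X](mulr0 B); apply: cvgMl_tmp.
Unshelve. all: by end_near. Qed.
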